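(* Let $\mathcal{L}=(\mathcal{L},[\cdot,\cdot],\triangleright)$ be a post-Lie algebra over $\mathbb{R}$ and let $f\in\mathcal{L}$. If the coefficients $\{a_{ij}\}_{i,j=1}^s$ and $\{b_j\}_{j=1}^s$ satisfy the classical Runge--Kutta order conditions up to order $p$, then the RKMK method with these coefficients is also of order $p$, i.e. $$\Psi_{\mathrm{RKMK}}(hf)-\exp^*(hf)=\mathcal{O}(h^{p+1}).$$
   Context: A post-Lie algebra $(\mathcal{L},[\cdot,\cdot],\triangleright)$ is a Lie algebra $(\mathcal{L},[\cdot,\cdot])$ with a bilinear product $\triangleright$ such that $x\triangleright[y,z]=[x\triangleright y,z]+[y,x\triangleright z]$ and $[x,y]\triangleright z=a_\triangleright(x,y,z)-a_\triangleright(y,x,z)$, where $a_\triangleright(x,y,z)=x\triangleright(y\triangleright z)-(x\triangleright y)\triangleright z$. $\mathcal{U}(\mathcal{L})$ is the universal enveloping algebra of the Lie algebra $(\mathcal{L},[\cdot,\cdot])$ with unit $\mathbf{1}$, concatenation product, and coproduct $\Delta$ the algebra morphism with $\Delta(x)=x\otimes\mathbf{1}+\mathbf{1}\otimes x$ for $x\in\mathcal{L}$ (Sweedler notation $\Delta(A)=A_{(1)}\otimes A_{(2)}$). The product $\triangleright$ extends uniquely to $\mathcal{U}(\mathcal{L})$ by $\mathbf{1}\triangleright A=A$; $(xA)\triangleright y=x\triangleright(A\triangleright y)-(x\triangleright A)\triangleright y$ for $x,y\in\mathcal{L}$; $A\triangleright(BC)=(A_{(1)}\triangleright B)(A_{(2)}\triangleright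 C)$. Set $A*B=A_{(1)}(A_{(2)}\triangleright B)$, an associative product. $\exp(f)=\sum_{n\ge0}\frac1{n!}f^n$ uses concatenation and $\exp^*(f)=\sum_{n\ge0}\frac1{n!}f^{*n}$ uses $*$. All identities are between formal power series in the formal parameter $h$ with coefficients in $\mathcal{U}(\mathcal{L})$, all operations being extended $h$-linearly. RKMK method: for real coefficients $a_{ij},b_i$ ($1\le i,j\le s$), $\Psi_{\mathrm{RKMK}}(f)$ is defined by $$U_i=\sum_{j=1}^sa_{ij}K_j,\qquad K_i=d\exp^{-1}_{U_i}\big(\exp(U_i)\triangleright f\big)\quad(i=1,\dots,s),\qquad \Psi_{\mathrm{RKMK}}(f)=\exp\Big(\sum_{i=1}^sb_iK_i\Big);$$ applied to $hf$, the $K_i$ are the unique solution in $h\mathcal{L}[[h]]$. Here $d\exp^{-1}_U$ is the inverse of the left-trivialized differential of $\exp$ (the latter defined by $\frac{d}{dt}\exp(\theta)=\exp(\theta)\,d\exp_\theta(\theta')$), given by $$d\exp^{-1}_U(V)=\sum_{k\ge0}\frac{B_k}{k!}\operatorname{ad}_U^{(k)}(V)=V+\tfrac12[U,V]+\tfrac1{12}[U,[U,V]]+\cdots,$$ where $\operatorname{ad}_U(V)=[U,V]$, $\operatorname{ad}_U^{(k)}$ is its $k$-th iterate, and $B_k$ are the Bernoulli numbers with $B_1=+\tfrac12$. Classical order conditions up to order $p$: for every non-planar rooted tree $\tau$ with at most $p$ nodes, $b\,\Phi(\tau)=1/\tau!$, where $A=(a_{ij})$, $b=(b_1,\dots,b_s)$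 is a row vector, $\Phi(\tau)\in\mathbb{R}^s$ is defined recursively by $\Phi(\bullet)=(1,\dots,1)^T$ for the one-node tree and $\Phi(B^+(\tau_1\cdots\tau_m))=(A\Phi(\tau_1))\cdot(A\Phi(\tau_2))\cdots(A\Phi(\tau_m))$ (componentwise product), $B^+(\tau_1\cdots\tau_m)$ being the tree whose root has branches $\tau_1,\dots,\tau_m$, and $\tau!=|\tau|\,\tau_1!\cdots\tau_m!$ for $\tau=B^+(\tau_1\cdots\tau_m)$ with $|\tau|$ the number of nodes (so $\bullet!=1$). *)

(* Defs.v *)
From HB Require Import structures.
From mathcomp Require Import all_boot all_order all_algebra.
From mathcomp Require Import boolp classical_sets reals.

Set Implicit Arguments.
Unset Strict Implicit.
Unset Printing Implicit Defensive.

Import Order.TTheory GRing.Theory Num.Theory.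
Local Open Scope ring_scope.

Record lie_bracket (R : realType) (L : lmodType R)
    (br : {bilinear L -> L -> L}) : Prop := LieBracket {
  lie_alt : forall x, br x x = 0;
  lie_jacobi : forall x y z,
    br x (br y z) + br y (br z x) + br z (br x y) = 0 }.

Definition associator (R : realType) (L : lmodType R) (m : L -> L -> L)
  (x y z : L) : L := m x (m y z) - m (m x y) z.

Record post_lie (R : realType) (L : lmodType R)
    (br tr : {bilinear L -> L -> L}) : Prop := PostLie {
  post_lie_bracket : lie_bracket br;
  post_lie_derivation : forall x y z,
    tr x (br y z) = br (tr x y) z + br y (tr x z);
  post_lie_assoc : forall x y z,
    tr (br x y) z = associator tr x y z - associator tr y x z }.

Definition commutator (R : realType) (A : algType R) (x y : A) : A :=
  x * y - y * x.

Definition lie_morphism (R : realType) (L : lmodType R)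
    (br : L -> L -> L) (A : algType R) (phi : L -> A) : Prop :=
  forall x y, phi (br x y) = commutator (phi x) (phi y).

(* The pair (U, iota) is the universal enveloping algebra of (L, br); it is
   determined by this property up to a unique isomorphism. *)
Record universal_enveloping (R : realType) (L : lmodType R)
    (br : L -> L -> L) (U : algType R) (iota : {linear L -> U}) : Prop :=
  UniversalEnveloping {
  uea_lie : lie_morphism br iota;
  uea_exists : forall (A : algType R) (phi : {linear L -> A}),
    lie_morphism br phi ->
    exists F : {lrmorphism U -> A}, forall x, F (iota x) = phi x;
  uea_unique : forall (A : algType R) (F G : {lrmorphism U -> A}),
    (forall x, F (iota x) = G (iota x)) -> F =1 G }.

(* The sequence [:: (u1, v1); ..; (uk, vk)] stands for the tensor
   u1 (x) v1 + .. + uk (x) vk of V (x) W. Two sequences stand for the same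
   tensor iff every bilinear map takes the same value on them. *)
Definition tensor_eq (R : realType) (V W : lmodType R)
    (s t : seq (V * W)) : Prop :=
  forall (X : lmodType R) (beta : {bilinear V -> W -> X}),
    \sum_(q <- s) beta q.1 q.2 = \sum_(q <- t) beta q.1 q.2.

(* Delta is a morphism of unital algebras from U to U (x) U, and the elements
   of L are primitive. A Sweedler sum of beta A_(1) A_(2), for beta bilinear,
   is then \sum_(q <- Delta A) beta q.1 q.2. *)
Record coproduct (R : realType) (L : lmodType R) (U : algType R)
    (iota : L -> U) (Delta : U -> seq (U * U)) : Prop := Coproduct {
  coproduct_linear : forall (c : R) (A B : U),
    tensor_eq (Delta (c *: A + B))
              ([seq (c *: q.1, q.2) | q <- Delta A] ++ Delta B);
  coproduct_one : tensor_eq (Delta 1) [:: (1, 1)];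
  coproduct_mul : forall A B : U,
    tensor_eq (Delta (A * B))
              [seq (q.1 * r.1, q.2 * r.2) | q <- Delta A, r <- Delta B];
  coproduct_prim : forall x : L,
    tensor_eq (Delta (iota x)) [:: (iota x, 1); (1, iota x)] }.

Record post_lie_extension (R : realType) (L : lmodType R) (tr : L -> L -> L)
    (U : algType R) (iota : L -> U) (Delta : U -> seq (U * U))
    (trU : {bilinear U -> U -> U}) : Prop := PostLieExtension {
  trU_iota : forall x y : L, trU (iota x) (iota y) = iota (tr x y);
  trU_one : forall A : U, trU 1 A = A;
  trU_mull : forall (x : L) (A : U) (y : L),
    trU (iota x * A) (iota y) =
      trU (iota x) (trU A (iota y)) - trU (trU (iota x) A) (iota y);
  trU_mulr : forall A B C : U,
    trU A (B * C) = \sum_(q <- Delta A) trU q.1 B * trU q.2 C }.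

Definition star (R : realType) (U : algType R) (Delta : U -> seq (U * U))
    (trU : U -> U -> U) (A B : U) : U :=
  \sum_(q <- Delta A) q.1 * trU q.2 B.

(* Formal power series in h with coefficients in V: the sequence F stands for
   the sum of the F n h^n. *)
Definition fps (V : Type) : Type := nat -> V.

(* h-linear extension of a bilinear operation *)
Definition fps_op (V W : Type) (X : nmodType) (op : V -> W -> X)
    (F : fps V) (G : fps W) : fps X :=
  fun n => \sum_(i < n.+1) op (F i) (G (n - i)%N).

Definition fps_const (V : nmodType) (v : V) : fps V :=
  fun n => if n == 0%N then v else 0.

Definition fps_h (V : nmodType) (v : V) : fps V :=
  fun n => if n == 1%N then v else 0.

Fixpoint fps_pow (R : realType) (U : algType R) (op : U -> U -> U)
    (F : fps U) (k : nat) : fps U :=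
  if k is k'.+1 then fps_op op (fps_pow op F k') F else fps_const 1.

(* Only used when F 0 = 0: the powers of F of exponent k > n then have no term
   in h^n, so the exponential series may be cut at k = n. *)
Definition fps_exp (R : realType) (U : algType R) (op : U -> U -> U)
    (F : fps U) : fps U :=
  fun n => \sum_(k < n.+1) (k`!%:R)^-1 *: fps_pow op F k n.

(* Bernoulli numbers B_0, .., B_n with B_1 = + 1 / 2, from the recursion
   B_n = 1 - \sum_(k < n) 'C(n, k) B_k / (n - k + 1). *)
Fixpoint bernoulli_seq (R : realType) (n : nat) : seq R :=
  if n is m.+1 then
    let s := bernoulli_seq R m in
    rcons s (1 - \sum_(k < n) 'C(n, k)%:R * s`_k / (n - k).+1%:R)
  else [:: 1].

Definition bernoulli (R : realType) (n : nat) : R := (bernoulli_seq R n)`_n.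

(* As for fps_exp, the series is cut at k = n because W 0 = 0. *)
Definition dexp_inv (R : realType) (U : algType R) (W V : fps U) : fps U :=
  fun n => \sum_(k < n.+1)
    (bernoulli R k / k`!%:R) *: iter k (fps_op (@commutator R U) W) V n.

Section RKMK.
Variables (R : realType) (L : lmodType R) (U : algType R).
Variables (iota : L -> U) (trU : U -> U -> U).
Variables (s : nat) (a : 'M[R]_s) (b : 'rV[R]_s).

(* L is mapped into U by iota, which turns the bracket of L into the
   commutator of U. *)
Definition rkmk_stages (F : fps L) (K : 'I_s -> fps L) : Prop :=
  (forall i, K i 0%N = 0) /\
  forall i,
    let Ui : fps U := fun n => iota (\sum_j a i j *: K j n) in
    (fun n => iota (K i n)) =
      dexp_inv Ui (fps_op trU (fps_exp *%R Ui) (fun n => iota (F n))).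

(* The solution K of the stage equations with coefficients in h L[[h]]; it is
   unique when F is in h L[[h]]. *)
Definition rkmk_solution (F : fps L) : 'I_s -> fps L :=
  xget (fun _ _ => 0) [set K | rkmk_stages F K]%classic.

Definition rkmk (F : fps L) : fps U :=
  fps_exp *%R (fun n => iota (\sum_i b 0 i *: rkmk_solution F i n)).

End RKMK.

(* Rooted trees with ordered branches. A non-planar rooted tree is a class of
   these modulo permutations of branches, on which tree_order, tree_fact and
   tree_weight are constant: a quantification over all rtree is one over all
   non-planar trees. *)
Inductive rtree : Type := Bplus of seq rtree.

Fixpoint tree_order (t : rtree) : nat :=
  let: Bplus ts := t in (sumn (map tree_order ts)).+1.

Fixpoint tree_fact (t : rtree) : nat :=
  let: Bplus ts := t in
  (tree_order t * \prod_(m <- map tree_fact ts) m)%N.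

Fixpoint tree_weight (R : realType) (s : nat) (a : 'M[R]_s) (t : rtree) :
    'cV[R]_s :=
  let: Bplus ts := t in
  \col_i \prod_(v <- map (tree_weight a) ts) (a *m v) i 0.

Definition order_conditions (R : realType) (s : nat) (a : 'M[R]_s)
    (b : 'rV[R]_s) (p : nat) : Prop :=
  forall t : rtree, (tree_order t <= p)%N ->
    (b *m tree_weight a t) 0 0 = (tree_fact t)%:R^-1.

Definition bigO_h (V : nmodType) (m : nat) (F : fps V) : Prop :=
  forall n, (n < m)%N -> F n = 0.

(* Main.v *)
Require Import Defs.
From HB Require Import structures.
From mathcomp Require Import all_boot all_order all_algebra.
From mathcomp Require Import boolp classical_sets reals.
From mathcomp Require Import ring.

Set Implicit Arguments.
Unset Strict Implicit.
Unset Printing Implicit Defensive.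

Import Order.TTheory GRing.Theory Num.Theory.
Local Open Scope ring_scope.

(** The method is a classical Runge-Kutta method in disguise. Write
    G(W) = dexp^-1_W (exp W |> f), a formal vector field on L. The stages of
    the method are those of the Runge-Kutta method with coefficients a, b for
    W' = G(W), W(0) = 0, and the result is the exponential of the numerical
    solution. So the theorem splits into two independent facts about the
    formal solution W of that equation.

    Exponentiating W gives the exact flow (exp_exact_flow). Put Y = exp W. The
    defining property of dexp^-1 turns the equation of W into Y' = Y (Y |> f)
    (euler_exp_dexp_inv). Since Y |> f lies in L, this equation forces Y to be
    group-like: Delta Y = Y (x) Y (grouplike_solution). Hence Y (Y |> f) is
    the product Y * f, and Y' = Y * f, Y(0) = 1 is solved coefficientwise by
    exp^*(h f) (solution_eq_exp_star).

    The numerical solution agrees with W up to order p (rk_order). Since G is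
    built from h f by multilinear operations only, substituting expansions
    over ordered rooted trees yields again such expansions, and grafting gives
      K_i = sum_t Phi_i(t) F(t) h^|t|   and   W = sum_t F(t) h^|t| / t!
    with the same elementary differentials F(t) in both. Working with ordered
    trees makes symmetry factors disappear. The order conditions identify the
    coefficients of sum_i b_i K_i with those of W.

    Time derivatives are replaced throughout by the Euler operator h d/dh,
    which does not lower the degree, so that the equation of W and the stage
    equations have literally the same right-hand side stage_rhs. Both are
    solved by the same fixed point argument (causal_fixpoint); the solutions
    stay in L because A |> y is in L for y in L (in_lie_trU). *)

(** * Formal power series with coefficients in an algebra *)

(** The two ways of enumerating the triples (j, k, l) with j + k + l = n; this
    is the associativity of convolution products. *)
Lemma sum_triangle (X : nmodType) (g : nat -> nat -> nat -> X) n :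
  \sum_(i < n.+1) \sum_(j < i.+1) g j (i - j)%N (n - i)%N =
  \sum_(j < n.+1) \sum_(k < (n - j).+1) g j k (n - j - k)%N.
Proof.
elim: n g => [|n IHn] g; first by rewrite !(big_ord_recl, big_ord0).
under eq_bigr do rewrite big_ord_recl subn0.
rewrite big_split /= [RHS]big_ord_recl subn0; congr (_ + _).
rewrite [LHS]big_ord_recl [X in X + _]big1 ?add0r; last by case.
exact: (IHn (fun j => g j.+1)).
Qed.

Lemma sum_antidiag_rev (X : nmodType) (g : nat -> nat -> X) n :
  \sum_(i < n.+1) g i (n - i)%N = \sum_(i < n.+1) g (n - i)%N i.
Proof.
rewrite (reindex_inj rev_ord_inj); apply: eq_bigr => i _ /=.
by rewrite subSS subKn // -ltnS.
Qed.

Section SeriesModule.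
Variables (R : realType) (V : lmodType R).

HB.instance Definition _ := Choice.copy (fps V) (nat -> V).

Let fps_add (F G : fps V) : fps V := fun n => F n + G n.
Let fps_opp (F : fps V) : fps V := fun n => - F n.
Let fps_zero : fps V := fun=> 0.
Let fps_scale (c : R) (F : fps V) : fps V := fun n => c *: F n.

Let fps_addA : associative fps_add.
Proof. by move=> F G H; apply: funext => n; apply: addrA. Qed.
Let fps_addC : commutative fps_add.
Proof. by move=> F G; apply: funext => n; apply: addrC. Qed.
Let fps_add0 : left_id fps_zero fps_add.
Proof. by move=> F; apply: funext => n; apply: add0r. Qed.
Let fps_addN : left_inverse fps_zero fps_opp fps_add.
Proof. by move=> F; apply: funext => n; apply: addNr. Qed.

HB.instance Definition _ :=
  GRing.isZmodule.Build (fps V) fps_addA fps_addC fps_add0 fps_addN.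

Let fps_scaleA c d F : fps_scale c (fps_scale d F) = fps_scale (c * d) F.
Proof. by apply: funext => n; apply: scalerA. Qed.
Let fps_scale1 : left_id 1 fps_scale.
Proof. by move=> F; apply: funext => n; apply: scale1r. Qed.
Let fps_scaleDr : right_distributive fps_scale +%R.
Proof. by move=> c F G; apply: funext => n; apply: scalerDr. Qed.
Let fps_scaleDl F : {morph fps_scale^~ F : c d / c + d}.
Proof. by move=> c d; apply: funext => n; apply: scalerDl. Qed.

HB.instance Definition _ := GRing.Zmodule_isLmodule.Build R (fps V)
  fps_scaleA fps_scale1 fps_scaleDr fps_scaleDl.

End SeriesModule.

Section SeriesAlgebra.
Variables (R : realType) (U : algType R).
Implicit Types F G H : fps U.

Let fps_mul F G : fps U := fps_op *%R F G.
Let fps_one : fps U := fps_const 1.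

Let fps_mulA : associative fps_mul.
Proof.
move=> F G H; apply: funext => n; rewrite /fps_mul /fps_op.
under eq_bigr do rewrite mulr_sumr.
under [RHS]eq_bigr do rewrite mulr_suml.
rewrite (sum_triangle (fun j k l => F j * G k * H l)).
by do 2![apply: eq_bigr => ? _]; rewrite mulrA.
Qed.

Let fps_mul1 : left_id fps_one fps_mul.
Proof.
move=> F; apply: funext => n; rewrite /fps_mul /fps_op big_ord_recl subn0 mul1r.
by rewrite big1 ?addr0 // => i _; rewrite mul0r.
Qed.

Let fps_mulr1 : right_id fps_one fps_mul.
Proof.
move=> F; apply: funext => n; rewrite /fps_mul /fps_op.
rewrite (sum_antidiag_rev (fun i j => F i * fps_one j)).
rewrite big_ord_recl subn0 mulr1.
by rewrite big1 ?addr0 // => i _; rewrite mulr0.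
Qed.

Let fps_mulDl : left_distributive fps_mul +%R.
Proof.
move=> F G H; apply: funext => n; rewrite [RHS]/GRing.add /= -big_split.
by apply: eq_bigr => i _; rewrite mulrDl.
Qed.

Let fps_mulDr : right_distributive fps_mul +%R.
Proof.
move=> F G H; apply: funext => n; rewrite [RHS]/GRing.add /= -big_split.
by apply: eq_bigr => i _; rewrite mulrDr.
Qed.

Let fps_1_neq0 : fps_one != 0.
Proof.
by apply/eqP => /(congr1 (fun F : fps U => F 0%N)) /eqP; rewrite oner_eq0.
Qed.

HB.instance Definition _ := GRing.Zmodule_isNzRing.Build (fps U)
  fps_mulA fps_mul1 fps_mulr1 fps_mulDl fps_mulDr fps_1_neq0.

Let fps_scaleAl (c : R) F G : c *: (F * G) = (c *: F) * G.
Proof.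
apply: funext => n; rewrite [LHS]/GRing.scale /= scaler_sumr.
by apply: eq_bigr => i _; rewrite scalerAl.
Qed.

HB.instance Definition _ :=
  GRing.Lmodule_isLalgebra.Build R (fps U) fps_scaleAl.

Let fps_scaleAr (c : R) F G : c *: (F * G) = F * (c *: G).
Proof.
apply: funext => n; rewrite [LHS]/GRing.scale /= scaler_sumr.
by apply: eq_bigr => i _; rewrite scalerAr.
Qed.

HB.instance Definition _ :=
  GRing.Lalgebra_isAlgebra.Build R (fps U) fps_scaleAr.

End SeriesAlgebra.

Lemma coef_fpsM (R : realType) (U : algType R) (F G : fps U) n :
  (F * G) n = \sum_(i < n.+1) F i * G (n - i)%N.
Proof. by []. Qed.

Lemma coef_fps_bigsum (R : realType) (V : lmodType R) I (r : seq I)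
    (P : pred I) (F : I -> fps V) n :
  (\sum_(i <- r | P i) F i) n = \sum_(i <- r | P i) F i n.
Proof. exact: (big_morph (fun F : fps V => F n)). Qed.

(** * Valuations and sums of series of increasing valuation *)

Lemma eq_fps_op (V W : Type) (X : nmodType) (op : V -> W -> X)
    (F F' : fps V) (G G' : fps W) n :
    (forall m, (m <= n)%N -> F m = F' m) ->
    (forall m, (m <= n)%N -> G m = G' m) ->
  fps_op op F G n = fps_op op F' G' n.
Proof.
move=> FF' GG'; apply: eq_bigr => i _.
by rewrite FF' ?GG' ?leq_subr // -ltnS.
Qed.

(** The operator h d/dh. *)
Definition euler (V : nmodType) (F : fps V) : fps V := fun n => F n *+ n.

(** The Leibniz rule, for products and for the bilinear maps that evaluate
    tensors alike. *)
Lemma euler_fps_op (V W X : nmodType) (op : V -> W -> X) (F : fps V)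
    (G : fps W) n :
    (forall v w k, op (v *+ k) w = op v w *+ k) ->
    (forall v w k, op v (w *+ k) = op v w *+ k) ->
  fps_op op F G n *+ n = fps_op op (euler F) G n + fps_op op F (euler G) n.
Proof.
move=> opl opr; rewrite -sumrMnl -big_split; apply: eq_bigr => i _ /=.
by rewrite opl opr -mulrnDr subnKC // -ltnS.
Qed.

Section Valuation.
Variables (R : realType) (V : lmodType R).
Implicit Types F G : fps V.

Lemma bigO_hD m F G : bigO_h m F -> bigO_h m G -> bigO_h m (F + G).
Proof.
by move=> Fm Gm n lt_nm; rewrite [LHS]/GRing.add /= Fm // Gm // addr0.
Qed.

Lemma bigO_hN m F : bigO_h m F -> bigO_h m (- F).
Proof. by move=> Fm n lt_nm; rewrite [LHS]/GRing.opp /= Fm // oppr0. Qed.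

Lemma bigO_hZ m c F : bigO_h m F -> bigO_h m (c *: F).
Proof. by move=> Fm n lt_nm; rewrite [LHS]/GRing.scale /= Fm // scaler0. Qed.

Lemma bigO_h_euler m F : bigO_h m F -> bigO_h m (euler F).
Proof. by move=> Fm n lt_nm; rewrite /euler Fm // mul0rn. Qed.

End Valuation.

Section SeriesOfSeries.
Variables (R : realType).

(** The sum of a series of series; it is meaningful when E k = O(h^k), as then
    the terms cut off do not contribute to the coefficient of h^n. *)
Definition fps_sum (V : lmodType R) (E : nat -> fps V) : fps V :=
  fun n => \sum_(k < n.+1) E k n.

Lemma fps_sumE (V : lmodType R) (E : nat -> fps V) n :
  fps_sum E n = \sum_(k < n.+1) E k n.
Proof. by []. Qed.

Lemma fps_sum_cut (V : lmodType R) (E : nat -> fps V) N n :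
    (forall k, bigO_h k (E k)) -> (n <= N)%N ->
  fps_sum E n = (\sum_(k < N.+1) E k) n.
Proof.
move=> hE le_nN; rewrite coef_fps_bigsum /fps_sum.
rewrite (big_ord_widen N.+1 (fun k => E k n)) //.
rewrite [RHS](bigID (fun k : 'I__ => (k < n.+1)%N)) /=.
rewrite [X in _ = _ + X]big1 ?addr0 // => k; rewrite -leqNgt => lt_nk.
exact: hE.
Qed.

(** The Cauchy product, for operators in place of left factors: operators T k
    that raise the valuation by k may be applied term by term, and the double
    sum regrouped along diagonals. *)
Lemma fps_sum_op (V W : lmodType R) (T : nat -> fps V -> fps W)
    (E : nat -> fps V) :
    (forall k F G, T k (F + G) = T k F + T k G) ->
    (forall k m F, bigO_h m F -> bigO_h (k + m) (T k F)) ->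
    (forall k, bigO_h k (E k)) ->
  fps_sum (fun k => T k (fps_sum E)) =
  fps_sum (fun m => \sum_(k < m.+1) T k (E (m - k)%N)).
Proof.
move=> TD Tval hE; apply: funext => n; rewrite !fps_sumE.
have T0 k : T k 0 = 0.
  by apply: (addrI (T k 0)); rewrite -TD !addr0.
under [RHS]eq_bigr do rewrite coef_fps_bigsum.
rewrite (sum_triangle (fun k j _ => T k (E j) n)); apply: eq_bigr => k _.
(* The tail fps_sum E - P has valuation above n, hence so has its image. *)
pose P := \sum_(j < n.+1) E j.
have -> : fps_sum E = P + (fps_sum E - P) by rewrite addrC subrK.
rewrite TD [LHS]/GRing.add /= [X in _ + X](_ : _ = 0); last first.
  apply: (Tval k n.+1); last by rewrite addnS ltnS leq_addl.
  move=> m; rewrite ltnS => le_mn.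
  rewrite [LHS]/GRing.add /= (fps_sum_cut hE le_mn).
  by rewrite /P [X in _ + X]/GRing.opp /= subrr.
rewrite addr0 (big_morph (T k) (TD k) (T0 k)) coef_fps_bigsum.
have le_kn : (n - k < n.+1)%N by rewrite ltnS leq_subr.
rewrite [RHS](big_ord_widen n.+1 (fun j => T k (E j) n)) //.
rewrite [LHS](bigID (fun j : 'I__ => (j < (n - k).+1)%N)) /=.
rewrite [X in _ + X]big1 ?addr0 // => j; rewrite -leqNgt => lt_nkj.
apply: (Tval _ _ _ (hE j)); rewrite -ltn_subLR //.
by rewrite -ltnS.
Qed.

Variable U : algType R.
Implicit Types F G W X : fps U.

Lemma bigO_hM m n F G : bigO_h m F -> bigO_h n G -> bigO_h (m + n) (F * G).
Proof.
move=> Fm Gn k lt_kmn; rewrite coef_fpsM big1 // => i _.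
have [lt_im|le_mi] := ltnP i m; first by rewrite Fm // mul0r.
rewrite Gn ?mulr0 // ltn_subLR; last by rewrite -ltnS.
by apply: leq_trans lt_kmn _; rewrite leq_add2r.
Qed.

Lemma bigO_hX k F : bigO_h 1 F -> bigO_h k (F ^+ k).
Proof.
move=> F1; elim: k => [|k IHk]; first by [].
by rewrite exprS -[k.+1]add1n; apply: bigO_hM.
Qed.

Lemma fps_sumM_l (E : nat -> fps U) G : (forall k, bigO_h k (E k)) ->
  fps_sum E * G = fps_sum (fun k => E k * G).
Proof.
move=> hE; apply: funext => n.
rewrite [RHS]/fps_sum -(coef_fps_bigsum _ xpredT (fun k : 'I_n.+1 => E k * G)).
rewrite -mulr_suml; apply: eq_fps_op => // m le_mn.
exact: fps_sum_cut.
Qed.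

Lemma fps_sumM (E E' : nat -> fps U) :
    (forall k, bigO_h k (E k)) -> (forall k, bigO_h k (E' k)) ->
  fps_sum E * fps_sum E' =
  fps_sum (fun m => \sum_(k < m.+1) E k * E' (m - k)%N).
Proof.
move=> hE hE'; rewrite fps_sumM_l // (fps_sum_op (T := fun k X => E k * X)) //.
- by move=> k F G; apply: mulrDr.
- by move=> k m F; apply: bigO_hM.
Qed.

End SeriesOfSeries.

(** * The adjoint action and Bernoulli numbers *)

Section Adjoint.
Variable A : nzRingType.
Implicit Types W X Y : A.

Definition ad W X : A := W * X - X * W.

Lemma adD W X Y : ad W (X + Y) = ad W X + ad W Y.
Proof. by rewrite /ad mulrDr mulrDl opprD addrACA. Qed.

Lemma iter_adD W k X Y :
  iter k (ad W) (X + Y) = iter k (ad W) X + iter k (ad W) Y.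
Proof. by elim: k => //= k ->; apply: adD. Qed.

(** Left multiplication by W is the sum of the commuting operators ad W and
    right multiplication by W: this is their binomial formula. *)
Lemma expr_mul_ad n W X :
  W ^+ n * X = \sum_(k < n.+1) iter k (ad W) X * W ^+ (n - k) *+ 'C(n, k).
Proof.
elim: n X => [|n IHn] X.
  by rewrite big_ord_recl big_ord0 addr0 bin0 /= mul1r mulr1.
rewrite exprSr -mulrA -{1}[W * X](subrK (X * W)) -/(ad W X) mulrDr mulrA !IHn.
rewrite mulr_suml [RHS]big_ord_recl /= bin0 subn0 mulr1n.
under [X in _ = _ + X]eq_bigr do rewrite /= /bump /= add1n subSS binS mulrnDr.
rewrite big_split /= addrA [LHS]addrC; congr (_ + _); last first.
  by apply: eq_bigr => k _; rewrite -iterS iterSr.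
rewrite -[LHS]addr0.
transitivity (\sum_(k < n.+2)
    iter k (ad W) X * W ^+ (n.+1 - k) *+ 'C(n, k)).
  rewrite [RHS]big_ord_recr /= bin_small // mulr0n; congr (_ + _).
  by apply: eq_bigr => k _; rewrite mulrnAl -mulrA -exprSr -subSn // -ltnS.
by rewrite big_ord_recl /= bin0 subn0.
Qed.

(** Leibniz gives the sum of the W^j (D W) W^(n-j); moving the powers of W to
    the right by expr_mul_ad, the binomials add up by Pascal's rule. *)
Lemma derivation_expr (D : A -> A) n W :
    (forall X Y, D (X * Y) = D X * Y + X * D Y) ->
  D (W ^+ n.+1) =
  \sum_(k < n.+1) iter k (ad W) (D W) * W ^+ (n - k) *+ 'C(n.+1, k.+1).
Proof.
move=> DM; elim: n => [|n IHn].
  by rewrite big_ord_recl big_ord0 addr0 /= mulr1.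
rewrite exprSr DM IHn expr_mul_ad.
under [RHS]eq_bigr do rewrite binS mulrnDr.
rewrite big_split /=; congr (_ + _).
rewrite [RHS]big_ord_recr /= bin_small // mulr0n addr0 mulr_suml.
by apply: eq_bigr => k _; rewrite mulrnAl -mulrA -exprSr -subSn // -ltnS.
Qed.

End Adjoint.

Section Bernoulli.
Variable R : realType.

Lemma size_bernoulli_seq n : size (bernoulli_seq R n) = n.+1.
Proof. by elim: n => //= n IHn; rewrite size_rcons IHn. Qed.

Lemma nth_bernoulli_seq n k : (k <= n)%N ->
  (bernoulli_seq R n)`_k = bernoulli R k.
Proof.
elim: n => [|n IHn]; first by rewrite leqn0 => /eqP ->.
rewrite leq_eqVlt => /predU1P[-> //|lt_kn].
by rewrite /= nth_rcons size_bernoulli_seq lt_kn IHn.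
Qed.

Lemma bernoulliS n : bernoulli R n.+1 =
  1 - \sum_(k < n.+1) 'C(n.+1, k)%:R * bernoulli R k / (n.+1 - k).+1%:R.
Proof.
rewrite {1}/bernoulli /= nth_rcons size_bernoulli_seq ltnn eqxx.
congr (1 - _); apply: eq_bigr => k _; rewrite nth_bernoulli_seq //.
by rewrite -ltnS.
Qed.

Lemma sum_bernoulli n :
  \sum_(k < n.+1) 'C(n, k)%:R * bernoulli R k / (n - k).+1%:R = 1.
Proof.
case: n => [|n]; last first.
  by rewrite big_ord_recr /= bernoulliS subnn binn mul1r divr1 addrC subrK.
by rewrite big_ord_recl big_ord0 addr0 bin0 subn0 /bernoulli /= !mul1r invr1.
Qed.

Lemma fact_neq0 n : n`!%:R != 0 :> R.
Proof. by rewrite pnatr_eq0 -lt0n fact_gt0. Qed.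

Lemma bin_div_fact n k : (k <= n)%N ->
  'C(n, k)%:R / n`!%:R = k`!%:R^-1 / (n - k)`!%:R :> R.
Proof.
move=> le_kn; rewrite -(bin_fact le_kn) !natrM.
have := bin_gt0 n k; rewrite le_kn lt0n -(pnatr_eq0 R) => C_neq0.
by field; rewrite C_neq0 !fact_neq0.
Qed.

(** The recursion of the Bernoulli numbers in terms of generating functions:
    b(x) (e^x - 1) / x = e^x, where b(x) is the sum of the B_k x^k / k!. *)
Lemma sum_bernoulli_fact n :
  \sum_(k < n.+1) k.+1`!%:R^-1 * (bernoulli R (n - k) / (n - k)`!%:R) =
  n`!%:R^-1.
Proof.
rewrite (sum_antidiag_rev (fun i j => i.+1`!%:R^-1 * (bernoulli R j / j`!%:R))).
transitivity ((\sum_(k < n.+1) 'C(n, k)%:R * bernoulli R k / (n - k).+1%:R)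
              / n`!%:R); last by rewrite sum_bernoulli mul1r.
rewrite mulr_suml; apply: eq_bigr => k _.
have le_kn : (k <= n)%N by rewrite -ltnS.
transitivity ('C(n, k)%:R / n`!%:R * (bernoulli R k / (n - k).+1%:R));
  last first.
  by rewrite mulrACA -[RHS]mulrA; congr (_ * _); apply: mulrC.
rewrite bin_div_fact // factS natrM invfM.
move: (_^-1) (_^-1) (_^-1) => x y z; ring.
Qed.

End Bernoulli.

(** * The differential of the exponential *)

Section ExponentialEquation.
Variables (R : realType) (U : algType R).
Implicit Types W V X F G : fps U.

Lemma eulerM F G : euler (F * G) = euler F * G + F * euler G.
Proof.
apply: funext => n; rewrite /euler coef_fpsM.
by apply: (euler_fps_op (op := *%R)) => v w k; rewrite (mulrnAl, mulrnAr).
Qed.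

Lemma eulerZ c F : euler (c *: F) = c *: euler F.
Proof.
by apply: funext => n; rewrite /euler [in RHS]/GRing.scale /= scalerMnr.
Qed.

Definition exp_term W k : fps U := k`!%:R^-1 *: W ^+ k.

Lemma fps_powE W k : fps_pow *%R W k = W ^+ k.
Proof. by elim: k => // k IHk; rewrite exprSr /= IHk. Qed.

Lemma fps_expE W : fps_exp *%R W = fps_sum (exp_term W).
Proof. by apply: funext => n; apply: eq_bigr => k _; rewrite fps_powE. Qed.

Lemma fps_op_commutator W X : fps_op (@commutator R U) W X = ad W X.
Proof.
apply: funext => n; rewrite /fps_op /commutator sumrB; congr (_ - _).
exact: (sum_antidiag_rev (fun i j => X j * W i)).
Qed.

Lemma dexp_invE W V : dexp_inv W V =
  fps_sum (fun k => (bernoulli R k / k`!%:R) *: iter k (ad W) V).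
Proof.
apply: funext => n; apply: eq_bigr => k _.
by congr (_ *: _ n); apply: eq_iter => X; apply: fps_op_commutator.
Qed.

Lemma adZ W c X : ad W (c *: X) = c *: ad W X.
Proof. by rewrite /ad -scalerAr -scalerAl scalerBr. Qed.

Lemma iter_adZ W k c X : iter k (ad W) (c *: X) = c *: iter k (ad W) X.
Proof. by elim: k => //= k ->; apply: adZ. Qed.

Variable W : fps U.
Hypothesis W1 : bigO_h 1 W.

Lemma bigO_h_ad m X : bigO_h m X -> bigO_h m.+1 (ad W X).
Proof.
move=> Xm; apply: bigO_hD; first by rewrite -add1n; apply: bigO_hM.
by rewrite -addn1; apply/bigO_hN/bigO_hM.
Qed.

Lemma bigO_h_iter_ad k m X : bigO_h m X -> bigO_h (k + m) (iter k (ad W) X).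
Proof. by move=> Xm; elim: k => //= k IHk; rewrite addSn; apply: bigO_h_ad. Qed.

Lemma bigO_h_exp_term k : bigO_h k (exp_term W k).
Proof. exact/bigO_hZ/bigO_hX. Qed.

(** From expr_mul_ad and a Cauchy product; the sum on the right is e^(ad W) X,
    the conjugate of X by exp W. *)
Lemma exp_mul_ad X : fps_exp *%R W * X =
  fps_sum (fun k => k`!%:R^-1 *: iter k (ad W) X) * fps_exp *%R W.
Proof.
rewrite fps_expE fps_sumM_l; last exact: bigO_h_exp_term.
rewrite fps_sumM; [|move=> k|exact: bigO_h_exp_term]; last first.
  by rewrite -[k in bigO_h k _]addn0; apply/bigO_hZ/bigO_h_iter_ad.
congr fps_sum; apply: funext => n.
rewrite /exp_term -scalerAl expr_mul_ad scaler_sumr; apply: eq_bigr => k _.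
rewrite -scalerAl -scalerAr !scalerA -bin_div_fact; last by rewrite -ltnS.
by rewrite -scaler_nat scalerA mulrC.
Qed.

(** The right-trivialized differential of exp, with generating function
    (e^x - 1) / x evaluated at ad W. *)
Lemma euler_exp : euler (fps_exp *%R W) =
  fps_sum (fun k => k.+1`!%:R^-1 *: iter k (ad W) (euler W)) * fps_exp *%R W.
Proof.
have term n : euler (exp_term W n.+1) = \sum_(k < n.+1)
    (k.+1`!%:R^-1 *: iter k (ad W) (euler W)) * exp_term W (n - k).
  rewrite /exp_term eulerZ (derivation_expr _ _ eulerM) scaler_sumr.
  apply: eq_bigr => k _; rewrite -scalerAl -scalerAr !scalerA.
  have le_kn : (k.+1 <= n.+1)%N by [].
  by rewrite -(bin_div_fact _ le_kn) -scaler_nat scalerA mulrC.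
rewrite fps_expE fps_sumM; last exact: bigO_h_exp_term; last first.
  move=> k; apply/bigO_hZ; rewrite -[k in bigO_h k _]addn0.
  exact: bigO_h_iter_ad.
apply: funext => n; rewrite /euler !fps_sumE -sumrMnl big_ord_recl.
rewrite [RHS]big_ord_recr /= -!term [LHS]addrC; congr (_ + _).
  by apply: eq_bigr => k _; rewrite -term.
(* The index shift leaves over the term k = 0 of exp W, killed by h d/dh, and
   on the other side a term of valuation n + 1. *)
transitivity (0 : U).
  rewrite /exp_term expr0 [X in X *+ n]/GRing.scale /=.
  by case: n => // n; rewrite scaler0 mul0rn.
by apply/esym/(bigO_h_euler (bigO_h_exp_term (k := n.+1))).
Qed.

(** Composing (e^x - 1) / x with b(x), both at x = ad W, gives e^x at ad W. *)
Lemma dexp_dexp_inv V :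
  fps_sum (fun k => k.+1`!%:R^-1 *: iter k (ad W) (dexp_inv W V)) =
  fps_sum (fun k => k`!%:R^-1 *: iter k (ad W) V).
Proof.
rewrite dexp_invE.
rewrite (fps_sum_op (T := fun k X => k.+1`!%:R^-1 *: iter k (ad W) X)).
- congr fps_sum; apply: funext => n.
  rewrite -sum_bernoulli_fact scaler_suml; apply: eq_bigr => k _.
  by rewrite iter_adZ scalerA -iterD subnKC // -ltnS.
- by move=> k F G; rewrite iter_adD scalerDr.
- by move=> k m F Fm; apply/bigO_hZ/bigO_h_iter_ad.
- move=> k; apply/bigO_hZ; rewrite -[k in bigO_h k _]addn0.
  exact: bigO_h_iter_ad.
Qed.

(** With D = h d/dh, D (exp W) = (e^(ad W) V) exp W = exp W V. Passing through
    the right-trivialized form of dexp avoids inverting the Bernoulli series,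
    since conjugation by exp W turns it into the left-trivialized one. *)
Theorem euler_exp_dexp_inv V : euler W = dexp_inv W V ->
  euler (fps_exp *%R W) = fps_exp *%R W * V.
Proof. by move=> dW; rewrite euler_exp dW dexp_dexp_inv -exp_mul_ad. Qed.

End ExponentialEquation.

(** * Group-like solutions and the exponential of the star product *)

Section BilinearMaps.
Variables (R : realType) (V W X : lmodType R).

(** Sweedler sums are evaluated on bilinear maps given by explicit formulas;
    this bundles such a formula with its proof of bilinearity. *)
Definition bilinear_pack (f : V -> W -> X) (hf : bilinear_for *:%R *:%R f) :
    {bilinear V -> W -> X} :=
  HB.pack f (bilinear_isBilinear.Build R V W X _ _ f hf).

Lemma tensor_eq_bilinear (f : V -> W -> X) (s t : seq (V * W)) :
    bilinear_for *:%R *:%R f -> tensor_eq s t ->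
  \sum_(q <- s) f q.1 q.2 = \sum_(q <- t) f q.1 q.2.
Proof. by move=> hf /(_ _ (bilinear_pack hf)). Qed.

End BilinearMaps.

Lemma mulrn_inj (R : realType) (V : lmodType R) n (v w : V) :
  (0 < n)%N -> v *+ n = w *+ n -> v = w.
Proof.
rewrite lt0n -(pnatr_eq0 R) => n_neq0 eq_vw.
by apply: (scalerI n_neq0); rewrite !scaler_nat.
Qed.

Lemma fps_op_h (V W X : nmodType) (op : V -> W -> X) (F : fps V) (w : W) n :
    (forall v, op v 0 = 0) ->
  fps_op op F (fps_h w) n = if n is m.+1 then op (F m) w else 0.
Proof.
move=> op0; case: n => [|n]; rewrite /fps_op big_ord_recr /= subnn /fps_h /=.
  by rewrite big_ord0 add0r.
rewrite op0 addr0 big_ord_recr /= subSn // subnn /= big1 ?add0r // => i _.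
by rewrite subSn 1?ltnW // -subSS subSn // ?eqSS subn_eq0 leqNgt ltn_ord.
Qed.

Section Sweedler.
Variables (R : realType) (L : lmodType R) (U : algType R).
Variables (iota : {linear L -> U}) (Delta : U -> seq (U * U)).
Hypothesis hDelta : coproduct iota Delta.

Section OneMap.
Variables (X : lmodType R) (beta : {bilinear U -> U -> X}).

Definition sweedler (A : U) : X := \sum_(q <- Delta A) beta q.1 q.2.

Lemma sweedlerP c A B : sweedler (c *: A + B) = c *: sweedler A + sweedler B.
Proof.
rewrite /sweedler (coproduct_linear hDelta) big_cat big_map scaler_sumr.
by congr (_ + _); apply: eq_bigr => q _; rewrite linearZl_LR.
Qed.

Lemma sweedlerD : {morph sweedler : A B / A + B}.
Proof. by move=> A B; rewrite -[A]scale1r sweedlerP !scale1r. Qed.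

Lemma sweedler0 : sweedler 0 = 0.
Proof. by apply: (addrI (sweedler 0)); rewrite -sweedlerD !addr0. Qed.

Lemma sweedlerZ c A : sweedler (c *: A) = c *: sweedler A.
Proof. by rewrite -[c *: A]addr0 sweedlerP sweedler0 addr0. Qed.

Lemma sweedlerMn n A : sweedler (A *+ n) = sweedler A *+ n.
Proof. by rewrite -!scaler_nat sweedlerZ. Qed.

Lemma sweedler_sum I (r : seq I) (P : pred I) (E : I -> U) :
  sweedler (\sum_(i <- r | P i) E i) = \sum_(i <- r | P i) sweedler (E i).
Proof. exact: (big_morph _ sweedlerD sweedler0). Qed.

Lemma sweedler1 : sweedler 1 = beta 1 1.
Proof. by rewrite /sweedler (coproduct_one hDelta) big_seq1. Qed.

Lemma bilinear_mulr_left (x : U) :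
  bilinear_for *:%R *:%R (fun v w => beta (v * x) w).
Proof.
split=> [w|v] c y z /=; last by rewrite linearPr.
by rewrite mulrDl -scalerAl linearPl.
Qed.

Lemma bilinear_mulr_right (x : U) :
  bilinear_for *:%R *:%R (fun v w => beta v (w * x)).
Proof.
split=> [w|v] c y z /=; first by rewrite linearPl.
by rewrite mulrDl -scalerAl linearPr.
Qed.

(** Delta (A x) = Delta A (x (x) 1 + 1 (x) x) for x in L. *)
Lemma sweedler_mul_prim A (x : L) : sweedler (A * iota x) =
  \sum_(q <- Delta A) beta (q.1 * iota x) q.2 +
  \sum_(q <- Delta A) beta q.1 (q.2 * iota x).
Proof.
rewrite /sweedler (coproduct_mul hDelta) big_allpairs_dep /= -big_split.
apply: eq_bigr => q _ /=.
have bil : bilinear_for *:%R *:%R (fun v w => beta (q.1 * v) (q.2 * w)).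
  split=> [w|v] c y z /=; rewrite mulrDr -scalerAr.
    by rewrite linearPl.
  by rewrite linearPr.
rewrite (tensor_eq_bilinear bil (coproduct_prim hDelta x)).
by rewrite big_cons big_seq1 /= !mulr1.
Qed.

End OneMap.

(** If Y' = Y V with V in L then Delta Y and Y (x) Y satisfy the same linear
    equation Z' = Z (V (x) 1 + 1 (x) V) with Z(0) = 1 (x) 1, which determines
    the coefficients recursively. The induction runs over all bilinear maps at
    once, as those needed in degree n involve right factors from V. *)
Theorem grouplike_solution (Y : fps U) (v : fps L) :
    Y 0%N = 1 -> v 0%N = 0 -> euler Y = Y * ((fun n => iota (v n)) : fps U) ->
  forall (X : lmodType R) (beta : {bilinear U -> U -> X}) n,
    sweedler beta (Y n) = fps_op beta Y Y n.
Proof.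
set V : fps U := fun n => iota (v n) => Y0 v0 dY X beta n.
elim/ltn_ind: n X beta => -[|n] IHn X beta.
  by rewrite /fps_op big_ord_recl big_ord0 addr0 Y0 sweedler1.
apply: (@mulrn_inj _ _ n.+1) => //; rewrite -sweedlerMn.
rewrite [Y n.+1 *+ _](congr1 (fun F : fps U => F n.+1) dY).
rewrite coef_fpsM sweedler_sum.
have V0 : V 0%N = 0 by rewrite /V v0 linear0.
(* The case i = n + 1 is beyond the induction hypothesis: there V 0 = 0. *)
have left i : (i <= n.+1)%N ->
    \sum_(q <- Delta (Y i)) beta (q.1 * V (n.+1 - i)%N) q.2 =
    \sum_(j < i.+1) beta (Y j * V (n.+1 - i)%N) (Y (i - j)%N).
  rewrite leq_eqVlt => /predU1P[->|lt_in].
    by rewrite subnn V0 !big1 // => k _; rewrite mulr0 linear0l.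
  exact: (IHn i lt_in X (bilinear_pack (bilinear_mulr_left beta _))).
have right i : (i <= n.+1)%N ->
    \sum_(q <- Delta (Y i)) beta q.1 (q.2 * V (n.+1 - i)%N) =
    \sum_(j < i.+1) beta (Y j) (Y (i - j)%N * V (n.+1 - i)%N).
  rewrite leq_eqVlt => /predU1P[->|lt_in].
    by rewrite subnn V0 !big1 // => k _; rewrite mulr0 linear0r.
  exact: (IHn i lt_in X (bilinear_pack (bilinear_mulr_right beta _))).
transitivity (\sum_(i < n.+2)
   (\sum_(j < i.+1) beta (Y j * V (n.+1 - i)%N) (Y (i - j)%N) +
    \sum_(j < i.+1) beta (Y j) (Y (i - j)%N * V (n.+1 - i)%N))).
  apply: eq_bigr => i _.
  by rewrite sweedler_mul_prim left ?right // -ltnS.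
rewrite big_split euler_fps_op => [|u w k|u w k]; last 2 first.
- by rewrite linearMnl.
- by rewrite linearMnr.
rewrite dY; congr (_ + _).
  rewrite (sum_triangle (fun j k l => beta (Y j * V l) (Y k))).
  rewrite /fps_op; under [RHS]eq_bigr do rewrite linear_sumlz.
  rewrite (sum_triangle (fun j k l => beta (Y j * V k) (Y l))).
  apply: eq_bigr => j _.
  exact: (sum_antidiag_rev (fun k l => beta (Y j * V l) (Y k))).
rewrite (sum_triangle (fun j k l => beta (Y j) (Y k * V l))).
by apply: eq_bigr => j _; rewrite linear_sumr.
Qed.

Variable trU : {bilinear U -> U -> U}.

Lemma bilinear_star (x : U) :
  bilinear_for *:%R *:%R (fun v w => v * trU w x).
Proof.
split=> [w|v] c y z /=; first by rewrite mulrDl -scalerAl.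
by rewrite linearPl mulrDr -scalerAr.
Qed.

Lemma star_sweedler A x :
  star Delta trU A x = sweedler (bilinear_pack (bilinear_star x)) A.
Proof. by []. Qed.

Lemma star0r A : star Delta trU A 0 = 0.
Proof. by rewrite /star big1 // => q _; rewrite linear0r mulr0. Qed.

(** The powers of h x are monomials, whose coefficients are the iterated right
    products by x. *)
Lemma fps_exp_star x n : fps_exp (star Delta trU) (fps_h x) n =
  n`!%:R^-1 *: iter n (fun A => star Delta trU A x) 1.
Proof.
have pow k m : fps_pow (star Delta trU) (fps_h x) k m =
    if m == k then iter k (fun A => star Delta trU A x) 1 else 0.
  elim: k m => [|k IHk] m; first by [].
  rewrite /= fps_op_h; last exact: star0r.
  case: m => // m; rewrite IHk eqSS; case: eqP => // _.
  by rewrite star_sweedler sweedler0.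
rewrite /fps_exp big_ord_recr big1 /= ?add0r ?pow ?eqxx // => k _.
by rewrite pow gtn_eqF ?scaler0.
Qed.

(** As Y is group-like, Y (Y |> x) = Y * x, so the coefficients of both sides
    satisfy (n + 1) Y_(n+1) = Y_n * x. *)
Theorem solution_eq_exp_star (Y : fps U) (v : fps L) (x : U) :
    Y 0%N = 1 -> (fun n => iota (v n)) = fps_op trU Y (fps_h x) ->
    euler Y = Y * ((fun n => iota (v n)) : fps U) ->
  v 0%N = 0 ->
  Y = fps_exp (star Delta trU) (fps_h x).
Proof.
move=> Y0 dv dY v0; apply: funext; elim=> [|n IHn].
  by rewrite fps_exp_star /= Y0 fact0 invr1 scale1r.
apply: (@mulrn_inj _ _ n.+1) => //.
have -> : Y n.+1 *+ n.+1 = star Delta trU (Y n) x.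
  rewrite star_sweedler (grouplike_solution Y0 v0 dY).
  rewrite [LHS](congr1 (fun F : fps U => F n.+1) dY) coef_fpsM big_ord_recr /=.
  rewrite subnn v0 linear0 mulr0 addr0; apply: eq_bigr => i _ /=.
  rewrite (congr1 (fun F : fps U => F (n.+1 - i)%N) dv).
  rewrite fps_op_h => [|u]; last by rewrite linear0r.
  by rewrite subSn // -ltnS.
rewrite IHn !fps_exp_star star_sweedler sweedlerZ -star_sweedler /=.
rewrite -scaler_nat scalerA factS natrM invfM mulrA divff ?mul1r //.
by rewrite pnatr_eq0.
Qed.

End Sweedler.

(** * Solving the stage equations inside the Lie algebra *)

(** A map whose n-th value depends only on the values before n stabilizes
    coefficientwise under iteration. *)
Lemma causal_fixpoint (T : Type) (x0 : nat -> T)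
    (step : (nat -> T) -> nat -> T) :
    (forall x y n, (forall m, (m < n)%N -> x m = y m) ->
      step x n = step y n) ->
  exists x, forall n, x n = step x n.
Proof.
move=> causal; pose z k := iter k step x0.
have stable k l m : (m < k)%N -> (m < l)%N -> z k m = z l m.
  elim: k l m => [//|k IHk] [//|l] m lt_mk lt_ml; apply: causal => j lt_jm.
  by apply: IHk; apply: leq_trans lt_jm _.
exists (fun n => z n.+1 n) => n.
by apply: (causal (z n)) => m lt_mn; apply: stable.
Qed.

Section StageRhs.
Variables (R : realType) (L : lmodType R).
Variables (br tr : {bilinear L -> L -> L}) (U : algType R).
Variables (iota : {linear L -> U}) (Delta : U -> seq (U * U)).
Variable trU : {bilinear U -> U -> U}.

(** The vector field h dexp^-1_W (exp W |> x), shared by the stages of the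
    method and by the differential equation that they discretize. *)
Definition stage_rhs (x : U) (W : fps U) : fps U :=
  dexp_inv W (fps_op trU (fps_exp *%R W) (fps_h x)).

Lemma eq_fps_exp (F G : fps U) n : (forall m, (m <= n)%N -> F m = G m) ->
  fps_exp *%R F n = fps_exp *%R G n.
Proof.
move=> FG; apply: eq_bigr => k _; congr (_ *: _).
move: (nat_of_ord k) => {}k; elim: k n FG => //= k IHk n FG.
apply: eq_fps_op => // m le_mn; apply: IHk => j le_jm.
by apply: FG; apply: leq_trans le_mn.
Qed.

Lemma stage_arg (x : U) (W : fps U) n : fps_op trU (fps_exp *%R W) (fps_h x) n =
  if n is m.+1 then trU (fps_exp *%R W m) x else 0.
Proof. by apply: fps_op_h => v; rewrite linear0r. Qed.

(** The factor h x has no constant term, so W n contributes in degrees above n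
    only. *)
Lemma stage_rhs_causal x (W W' : fps U) n :
    (forall m, (m < n)%N -> W m = W' m) -> stage_rhs x W n = stage_rhs x W' n.
Proof.
move=> WW'; apply: eq_bigr => k _; congr (_ *: _).
set V := fps_op _ _ _; set V' := fps_op _ _ _.
have VV' m : (m <= n)%N -> V m = V' m.
  rewrite /V /V' !stage_arg; case: m => // m lt_mn; congr (trU _ _).
  by apply: eq_fps_exp => j le_jm; apply: WW'; apply: leq_ltn_trans lt_mn.
have V0 : V 0%N = 0 by rewrite /V stage_arg.
suff [eqn _] : (forall m, (m <= n)%N ->
    iter k (fps_op (@commutator R U) W) V m =
    iter k (fps_op (@commutator R U) W') V' m) /\
  iter k (fps_op (@commutator R U) W) V 0%N = 0 by apply: eqn.
elim: {k}(k : nat) => [//|k [IHk IHk0]] /=; split=> [m le_mn|]; last first.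
  by rewrite /fps_op big_ord1 IHk0 /commutator mulr0 mul0r subrr.
rewrite /fps_op !big_ord_recr /= subnn -(IHk 0%N) // IHk0.
rewrite /commutator !(mulr0, mul0r); congr (_ + _); apply: eq_bigr => i _.
have lt_im := ltn_ord i.
by rewrite WW' ?IHk ?(leq_trans (leq_subr _ _)) // (leq_trans lt_im).
Qed.

Hypothesis hbr : lie_morphism br iota.
Hypothesis hDelta : coproduct iota Delta.
Hypothesis htrU : post_lie_extension tr iota Delta trU.

(** As Delta x = x (x) 1 + 1 (x) x, the element x acts as a derivation. *)
Lemma trU_derivation x B C :
  trU (iota x) (B * C) = trU (iota x) B * C + B * trU (iota x) C.
Proof.
rewrite (trU_mulr htrU).
have bil : bilinear_for *:%R *:%R (fun v w => trU v B * trU w C).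
  split=> [w|v] c y z /=; first by rewrite linearPl mulrDl -scalerAl.
  by rewrite linearPl mulrDr -scalerAr.
rewrite (tensor_eq_bilinear bil (coproduct_prim hDelta x)).
by rewrite big_cons big_seq1 /= !(trU_one htrU).
Qed.

Lemma trU_prim_one x : trU (iota x) 1 = 0.
Proof.
have := trU_derivation x 1 1; rewrite !mulr1 mul1r => /eqP.
by rewrite -subr_eq0 opprD addNKr oppr_eq0 => /eqP.
Qed.

(** Sums of products of k elements of L. The length is what decreases
    in the recursion for (x A) |> y: the element x |> A that occurs there is a
    sum of products of the same length as A. *)
Inductive lie_word : nat -> U -> Prop :=
| lie_word1 : lie_word 0 1
| lie_wordM k x A : lie_word k A -> lie_word k.+1 (iota x * A)
| lie_word0 k : lie_word k 0
| lie_wordD k A B : lie_word k A -> lie_word k B -> lie_word k (A + B).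

Lemma lie_word_trU x k A : lie_word k A -> lie_word k (trU (iota x) A).
Proof.
elim=> [|{}k y {}A kA IH|{}k|{}k {}A B _ IHA _ IHB].
- by rewrite trU_prim_one; apply: lie_word0.
- rewrite trU_derivation (trU_iota htrU).
  by apply: lie_wordD; apply: lie_wordM.
- by rewrite linear0r; apply: lie_word0.
- by rewrite linearDr; apply: lie_wordD.
Qed.

Definition in_lie (A : U) : Prop := exists x, iota x = A.

Lemma in_lie0 : in_lie 0.
Proof. by exists 0; rewrite linear0. Qed.

Lemma in_lieD A B : in_lie A -> in_lie B -> in_lie (A + B).
Proof. by case=> x <- [y <-]; exists (x + y); rewrite linearD. Qed.

Lemma in_lieN A : in_lie A -> in_lie (- A).
Proof. by case=> x <-; exists (- x); rewrite linearN. Qed.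

Lemma in_lieZ c A : in_lie A -> in_lie (c *: A).
Proof. by case=> x <-; exists (c *: x); rewrite linearZ. Qed.

Lemma in_lie_sum I (r : seq I) (P : pred I) (F : I -> U) :
    (forall i, P i -> in_lie (F i)) ->
  in_lie (\sum_(i <- r | P i) F i).
Proof. by move=> PF; elim/big_ind: _; [exact: in_lie0|exact: in_lieD|]. Qed.

(** Induction on word length through (x A) |> y = x |> (A |> y) - (x |> A) |> y,
    where A and x |> A both have one letter less than x A. *)
Lemma in_lie_trU k A y : lie_word k A -> in_lie (trU A (iota y)).
Proof.
elim: k A => [|k IHk] A; [move Em: 0%N => m mA|move Em: k.+1 => m mA].
  elim: mA Em => // [_||].
  - by exists y; rewrite (trU_one htrU).
  - by move=> *; rewrite linear0l; apply: in_lie0.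
  - by move=> l B C _ IHB _ IHC El; rewrite linearDl; apply: in_lieD; auto.
elim: mA Em => // [l x B lB _ [El]|*|l B C _ IHB _ IHC El].
- subst l; rewrite (trU_mull htrU); apply: in_lieD; last first.
    by apply/in_lieN/IHk/lie_word_trU.
  have [z <-] := IHk B lB.
  by exists (tr x z); rewrite (trU_iota htrU).
- by rewrite linear0l; apply: in_lie0.
- by rewrite linearDl; apply: in_lieD; auto.
Qed.

Lemma lie_word_expr (u : fps L) k n :
  lie_word k ((((fun m => iota (u m)) : fps U) ^+ k) n).
Proof.
elim: k n => [|k IHk] n.
  by rewrite expr0; case: n => [|n]; [apply: lie_word1 | apply: lie_word0].
rewrite exprS coef_fpsM; elim/big_ind: _ => [|A B|i _].
- exact: lie_word0.
- exact: lie_wordD.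
- exact: lie_wordM.
Qed.

Lemma in_lie_stage_arg (u : fps L) (f : L) n :
  in_lie (fps_op trU (fps_exp *%R (fun m => iota (u m))) (fps_h (iota f)) n).
Proof.
rewrite stage_arg; case: n => [|n]; first exact: in_lie0.
rewrite linear_sumlz; apply: in_lie_sum => k _.
rewrite linearZl_LR; apply: in_lieZ; rewrite fps_powE.
exact: in_lie_trU (lie_word_expr u k n).
Qed.

Lemma in_lie_stage_rhs (u : fps L) (f : L) n :
  in_lie (stage_rhs (iota f) (fun m => iota (u m)) n).
Proof.
apply: in_lie_sum => k _; apply: in_lieZ.
move: (nat_of_ord k) => {}k.
elim: k n => [|k IHk] n; first exact: in_lie_stage_arg.
rewrite iterS; apply: in_lie_sum => i _; have [z <-] := IHk (n - i)%N.
by exists (br (u i) z); rewrite hbr.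
Qed.

(** A choice of preimages that depends on the element of U only, so that the
    fixed point maps below are causal. *)
Definition iota_preim (A : U) : L := xget 0 [set x | iota x = A]%classic.

Lemma iota_preimK A : in_lie A -> iota (iota_preim A) = A.
Proof. exact: (xgetPex 0 (P := [set x | iota x = A]%classic)). Qed.

Lemma rkmk_stagesP (s : nat) (a : 'M[R]_s) (f : L) (K : 'I_s -> fps L) :
  rkmk_stages iota trU a (fps_h f) K <->
  (forall i, K i 0%N = 0) /\
  (forall i, (fun n => iota (K i n)) =
    stage_rhs (iota f) (fun n => iota (\sum_j a i j *: K j n))).
Proof.
rewrite /stage_rhs.
suff -> : fps_h (iota f) = (fun n => iota (fps_h f n)) by [].
by apply: funext => n; rewrite /fps_h; case: eqP => // _; rewrite linear0.
Qed.

Lemma rkmk_stages_exist (s : nat) (a : 'M[R]_s) (f : L) :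
  exists K : 'I_s -> fps L, rkmk_stages iota trU a (fps_h f) K.
Proof.
pose step (K : nat -> 'I_s -> L) n i : L :=
  if n == 0%N then 0 else iota_preim
    (stage_rhs (iota f) (fun m => iota (\sum_j a i j *: K m j)) n).
have [|K KE] := @causal_fixpoint _ (fun _ _ => 0) step.
  move=> K K' n KK'; apply: funext => i; rewrite /step; case: eqP => // _.
  congr iota_preim; apply: stage_rhs_causal => m lt_mn.
  by rewrite KK'.
exists (fun i n => K n i); apply/rkmk_stagesP; split=> i; first by rewrite KE.
apply: funext => n; rewrite KE /step; case: eqP => [->|_]; last first.
  exact/iota_preimK/in_lie_stage_rhs.
by rewrite linear0 /stage_rhs /dexp_inv big_ord1 /= stage_arg scaler0.
Qed.

(** Integrating h d/dh divides the coefficient of h^n by n. For n = 0 the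
    quotient is 0 since 0^-1 = 0, which is the initial value wanted. *)
Lemma exact_flow_exists (f : L) : exists theta : fps L,
  [/\ iota (theta 0%N) = 0 &
      euler ((fun n => iota (theta n)) : fps U) =
        stage_rhs (iota f) (fun n => iota (theta n))].
Proof.
pose step (u : nat -> L) n : L :=
  iota_preim (n%:R^-1 *: stage_rhs (iota f) (fun m => iota (u m)) n).
have [|u uE] := @causal_fixpoint _ (fun=> 0) step.
  move=> u u' n uu'; rewrite /step; congr (iota_preim (_ *: _)).
  by apply: stage_rhs_causal => m lt_mn; rewrite uu'.
have iuE n : iota (u n) = n%:R^-1 *: stage_rhs (iota f) (fun m => iota (u m)) n.
  by rewrite {1}uE iota_preimK //; apply/in_lieZ/in_lie_stage_rhs.
exists u; split; first by rewrite iuE invr0 scale0r.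
apply: funext => -[|n]; rewrite /euler.
  by rewrite mulr0n /stage_rhs /dexp_inv big_ord1 /= stage_arg scaler0.
by rewrite iuE -scaler_nat scalerA divff ?scale1r // pnatr_eq0.
Qed.

(** With V = exp W |> (h f), the equation of W reads D W = dexp^-1_W V, so that
    exp W satisfies D (exp W) = exp W V with V in L. *)
Theorem exp_exact_flow (f : L) (theta : fps L) :
    iota (theta 0%N) = 0 ->
    euler ((fun n => iota (theta n)) : fps U) =
      stage_rhs (iota f) (fun n => iota (theta n)) ->
  fps_exp *%R (fun n => iota (theta n)) =
  fps_exp (star Delta trU) (fps_h (iota f)).
Proof.
set W : fps U := fun n => iota (theta n) => W0 dW.
have W1 : bigO_h 1 W by case.
pose V := fps_op trU (fps_exp *%R W) (fps_h (iota f)).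
pose v n : L := if n == 0%N then 0 else iota_preim (V n).
have vV : (fun n => iota (v n)) = V.
  apply: funext => n; rewrite /v; case: eqP => [->|_].
    by rewrite linear0 /V stage_arg.
  exact/iota_preimK/in_lie_stage_arg.
apply: (solution_eq_exp_star hDelta (v := v)) => //.
  by rewrite /fps_exp big_ord1 /= fact0 invr1 scale1r.
by rewrite vV; apply: (euler_exp_dexp_inv W1).
Qed.

End StageRhs.

(** * Expansions over ordered forests and the classical order theory *)

(* Membership in a list of forests needs decidable equality on trees. *)
HB.instance Definition _ := gen_eqMixin rtree.

Section ForestExpansions.
Variables (R : realType) (s : nat) (a : 'M[R]_s).

Definition forest_order (w : seq rtree) : nat := sumn (map tree_order w).

Definition forest_weight (w : seq rtree) (i : 'I_s) : R :=
  \prod_(v <- map (tree_weight a) w) (a *m v) i 0.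

Definition forest_fact (w : seq rtree) : nat :=
  (\prod_(m <- map tree_fact w) m)%N.

(** A simultaneous expansion of a family x and of a vector y with the same
    vectors q.2, standing for elementary differentials, and with coefficients
    the weights of the method for x and the inverse factorials, those of the
    exact solution, for y. All forests have n - c nodes: c counts factors h
    that do not yet come with a node, that is, 0 for series in the unknowns
    and 1 for the right-hand sides, where h f is the root to come. *)
Definition forest_expansion (V : lmodType R) (c n : nat)
    (x : 'I_s -> V) (y : V) : Prop :=
  exists r : seq (seq rtree * V),
  [/\ all (fun q => forest_order q.1 + c == n)%N r,
      forall i, x i = \sum_(q <- r) forest_weight q.1 i *: q.2 &
      y = \sum_(q <- r) (forest_fact q.1)%:R^-1 *: q.2].

Section Closure.
Variables V W X : lmodType R.
Implicit Types (c n : nat).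

Lemma forest_expansion_unit c (v : V) : forest_expansion c c (fun=> v) v.
Proof.
exists [:: ([::], v)]; split; first by rewrite /= add0n eqxx.
  by move=> i; rewrite big_seq1 /forest_weight big_nil scale1r.
by rewrite big_seq1 /forest_fact big_nil invr1 scale1r.
Qed.

Lemma forest_expansion0 c n : forest_expansion c n (fun=> 0 : V) 0.
Proof. by exists [::]; split=> // [i|]; rewrite big_nil. Qed.

Lemma forest_expansionD c n (x x' : 'I_s -> V) y y' :
    forest_expansion c n x y -> forest_expansion c n x' y' ->
  forest_expansion c n (fun i => x i + x' i) (y + y').
Proof.
move=> [r [r_n xE yE]] [r' [r'_n xE' yE']]; exists (r ++ r').
split; first by rewrite all_cat r_n r'_n.
  by move=> i; rewrite big_cat xE xE'.
by rewrite big_cat yE yE'.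
Qed.

Lemma forest_expansion_sum c n I (r : seq I) (x : I -> 'I_s -> V)
    (y : I -> V) :
    (forall k, forest_expansion c n (x k) (y k)) ->
  forest_expansion c n (fun i => \sum_(k <- r) x k i) (\sum_(k <- r) y k).
Proof.
move=> xy; elim: r => [|k r IHr].
  have [r [r_n xE yE]] := forest_expansion0 c n.
  by exists r; split=> // [i|]; rewrite big_nil // xE.
have [r' [r_n xE yE]] := forest_expansionD (xy k) IHr.
by exists r'; split=> // [i|]; rewrite big_cons // xE.
Qed.

(** Both coefficients are multiplicative on forests, so concatenating forests
    expands a product of expansions. *)
Lemma forest_expansion_bilinear (beta : {bilinear V -> W -> X}) c d m n
    (x : 'I_s -> V) y (x' : 'I_s -> W) y' :
    forest_expansion c m x y -> forest_expansion d n x' y' ->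
  forest_expansion (c + d) (m + n) (fun i => beta (x i) (x' i)) (beta y y').
Proof.
move=> [r [r_m xE yE]] [r' [r'_n xE' yE']].
exists [seq (q.1 ++ q'.1, beta q.2 q'.2) | q <- r, q' <- r']; split.
- apply/allP=> _ /allpairsP[[q q'] /= [qr q'r' ->]] /=.
  rewrite /forest_order map_cat sumn_cat addnACA.
  by rewrite (eqP (allP r_m q qr)) (eqP (allP r'_n q' q'r')).
- move=> i; rewrite xE xE' linear_sumlz big_allpairs_dep /=.
  apply: eq_bigr => q _; rewrite linear_sumr; apply: eq_bigr => q' _ /=.
  rewrite /forest_weight map_cat big_cat /= linearZl_LR linearZr_LR scalerA.
  by [].
- rewrite yE yE' linear_sumlz big_allpairs_dep /=.
  apply: eq_bigr => q _; rewrite linear_sumr; apply: eq_bigr => q' _ /=.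
  rewrite /forest_fact map_cat big_cat /= natrM invfM.
  by rewrite linearZl_LR linearZr_LR scalerA.
Qed.

End Closure.

Lemma forest_expansionZ (V : lmodType R) c n k (x : 'I_s -> V) y :
    forest_expansion c n x y ->
  forest_expansion c n (fun i => k *: x i) (k *: y).
Proof.
move=> [r [r_n xE yE]]; exists [seq (q.1, k *: q.2) | q <- r].
split; first by rewrite all_map.
  move=> i; rewrite big_map xE scaler_sumr; apply: eq_bigr => q _ /=.
  by rewrite !scalerA mulrC.
rewrite big_map yE scaler_sumr; apply: eq_bigr => q _ /=.
by rewrite !scalerA mulrC.
Qed.

Definition series_expansion (V : lmodType R) (c : nat) (x : 'I_s -> fps V)
    (y : fps V) : Prop :=
  forall n, forest_expansion c n (fun i => x i n) (y n).

Lemma series_expansion_op (V W X : lmodType R)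
    (beta : {bilinear V -> W -> X}) c d x y x' y' :
    series_expansion c x y -> series_expansion d x' y' ->
  series_expansion (c + d) (fun i => fps_op beta (x i) (x' i))
    (fps_op beta y y').
Proof.
move=> xy xy' n; apply: forest_expansion_sum => i.
have le_in : (i <= n)%N by rewrite -ltnS.
have := forest_expansion_bilinear beta (xy i) (xy' (n - i)%N).
by rewrite subnKC.
Qed.

Lemma series_expansion_h (V : lmodType R) (v : V) :
  series_expansion 1 (fun=> fps_h v) (fps_h v).
Proof.
move=> n; rewrite /fps_h; case: eqP => [->|_].
  exact: forest_expansion_unit.
exact: forest_expansion0.
Qed.

Variable U : algType R.

Lemma bilinear_mul : bilinear_for *:%R *:%R ( *%R : U -> U -> U).
Proof.
split=> [w|v] c x y /=; first by rewrite mulrDl scalerAl.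
by rewrite mulrDr scalerAr.
Qed.

Lemma bilinear_commutator : bilinear_for *:%R *:%R (@commutator R U).
Proof.
split=> [w|v] c x y; rewrite /commutator /= mulrDl mulrDr;
  by rewrite -scalerAl -scalerAr scalerBr opprD addrACA.
Qed.

Lemma series_expansion_exp (x : 'I_s -> fps U) y :
    series_expansion 0 x y ->
  series_expansion 0 (fun i => fps_exp *%R (x i)) (fps_exp *%R y).
Proof.
move=> xy; have pow k : series_expansion 0
    (fun i => fps_pow *%R (x i) k) (fps_pow *%R y k).
  elim: k => [|k IHk].
    move=> n; rewrite /= /fps_const; case: eqP => [->|_].
      exact: forest_expansion_unit.
    exact: forest_expansion0.
  exact: (series_expansion_op (bilinear_pack bilinear_mul) IHk xy).
move=> n; apply: forest_expansion_sum => k.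
by apply: forest_expansionZ; apply: pow.
Qed.

Lemma series_expansion_dexp_inv (x : 'I_s -> fps U) y v w c :
    series_expansion 0 x y -> series_expansion c v w ->
  series_expansion c (fun i => dexp_inv (x i) (v i)) (dexp_inv y w).
Proof.
move=> xy vw; have iterated k : series_expansion c
    (fun i => iter k (fps_op (@commutator R U) (x i)) (v i))
    (iter k (fps_op (@commutator R U) y) w).
  elim: k => [|k IHk]; first exact: vw.
  exact: (series_expansion_op (bilinear_pack bilinear_commutator) xy IHk).
move=> n; apply: forest_expansion_sum => k.
by apply: forest_expansionZ; apply: iterated.
Qed.

Lemma series_expansion_stage_rhs (trU : {bilinear U -> U -> U}) f
    (x : 'I_s -> fps U) y : series_expansion 0 x y ->
  series_expansion 1 (fun i => stage_rhs trU f (x i)) (stage_rhs trU f y).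
Proof.
move=> xy; apply: series_expansion_dexp_inv => //.
have xy_exp := series_expansion_exp xy.
exact: (series_expansion_op trU xy_exp (series_expansion_h f)).
Qed.

Lemma forest_weight_Bplus w i :
  forest_weight w i = tree_weight a (Bplus w) i 0.
Proof. by rewrite mxE. Qed.

(** Grafting the forest of each term of K on a new root makes the root account
    for the factor h. Then A Phi is the weight of the resulting tree, and the
    division by n = |t| that integrates D y produces the tree factorial. *)
Lemma forest_expansion_graft (V : lmodType R) n (k : 'I_s -> V) (y : V) :
    (n = 0%N -> y = 0) ->
    forest_expansion 1 n k (y *+ n) ->
  forest_expansion 0 n (fun i => \sum_j a i j *: k j) y.
Proof.
move=> y0 [r [r_n kE yE]]; exists [seq ([:: Bplus q.1], q.2) | q <- r]; split.
- rewrite all_map; apply: sub_all r_n => q /=.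
  by rewrite /forest_order /= !addn0 addn1.
- move=> i; rewrite big_map; under [LHS]eq_bigr do rewrite kE scaler_sumr.
  rewrite exchange_big; apply: eq_bigr => q _ /=.
  rewrite /forest_weight /= big_seq1 mxE scaler_suml; apply: eq_bigr => j _.
  by rewrite scalerA -forest_weight_Bplus.
- case: n y0 r_n yE => [->//|n _] r_n yE.
    case: r {kE yE} r_n => [|q r]; first by rewrite big_nil.
    by rewrite /= addn1.
  apply: (@mulrn_inj _ _ n.+1) => //; rewrite yE big_map -sumrMnl.
  rewrite big_seq [RHS]big_seq; apply: eq_bigr => q qr.
  have /eqP := allP r_n q qr; rewrite addn1 => order_q.
  rewrite /= /forest_fact /= big_seq1 -scaler_nat scalerA; congr (_ *: _).
  rewrite -/(forest_order q.1) order_q natrM invfM mulrA divff ?mul1r //.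
  by rewrite pnatr_eq0.
Qed.

End ForestExpansions.

Section ClassicalOrderTheory.
Variables (R : realType) (U : algType R) (trU : {bilinear U -> U -> U}).
Variables (f : U) (s : nat) (a : 'M[R]_s) (b : 'rV[R]_s).
Variables (K : 'I_s -> fps U) (W : fps U).
Hypothesis KE : forall i,
  K i = stage_rhs trU f (fun n => \sum_j a i j *: K j n).
Hypothesis W0 : W 0%N = 0.
Hypothesis WE : euler W = stage_rhs trU f W.

(** Induction on the degree. The closure properties are about whole series,
    so the unknowns are cut at degree n, which does not change the right-hand
    side in that degree. *)
Lemma stage_expansion n : forest_expansion a 1 n (fun i => K i n) (W n *+ n).
Proof.
elim/ltn_ind: n => n IHn.
pose cut (F : fps U) : fps U := fun m => if (m < n)%N then F m else 0.
have cutE F : stage_rhs trU f (cut F) n = stage_rhs trU f F n.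
  by apply: stage_rhs_causal => m lt_mn; rewrite /cut lt_mn.
have cut_expansion : series_expansion a 0
    (fun i => cut (fun m => \sum_j a i j *: K j m)) (cut W).
  move=> m; rewrite /cut; case: ltnP => [lt_mn|_].
    by apply: forest_expansion_graft => [->|]; [exact: W0 | exact: IHn].
  exact: forest_expansion0.
have [r [r_n xE yE]] := series_expansion_stage_rhs trU f cut_expansion n.
exists r; split=> // [i|]; first by rewrite KE -cutE xE.
by rewrite -yE cutE -WE.
Qed.

(** In degree n the expansions of K_i and W run over trees with n nodes, for
    which the order conditions equate the coefficients. *)
Theorem rk_order p n : order_conditions a b p -> (n <= p)%N ->
  \sum_i b 0 i *: K i n = W n.
Proof.
move=> hab le_np; have [r [r_n kE wE]] := stage_expansion n.
case: n le_np r_n kE wE => [|n] le_np r_n kE wE.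
  rewrite W0 big1 // => i _; rewrite kE; case: r r_n {kE wE} => [|q r].
    by rewrite big_nil scaler0.
  by rewrite /= addn1.
apply: (@mulrn_inj _ _ n.+1) => //; rewrite wE -sumrMnl.
under eq_bigr do rewrite kE scaler_sumr -sumrMnl.
rewrite exchange_big big_seq [RHS]big_seq; apply: eq_bigr => q qr /=.
have /eqP := allP r_n q qr; rewrite addn1 => order_q.
under eq_bigr do rewrite scalerA -scaler_nat scalerA.
rewrite -scaler_suml -mulr_sumr; congr (_ *: _).
have := hab (Bplus q.1); rewrite /= -/(forest_order q.1) order_q => /(_ le_np).
rewrite mxE natrM invfM => tree_cond.
transitivity (n.+1%:R * (n.+1%:R^-1 * (forest_fact q.1)%:R^-1) : R).
  by rewrite -tree_cond; congr (_ * _); apply: eq_bigr => i _; rewrite mxE.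
by rewrite mulrA divff ?mul1r // pnatr_eq0.
Qed.

End ClassicalOrderTheory.

Theorem theorem4p11 (R : realType) (L : lmodType R)
    (br tr : {bilinear L -> L -> L}) (hL : post_lie br tr)
    (U : algType R) (iota : {linear L -> U})
    (hU : universal_enveloping br iota)
    (Delta : U -> seq (U * U)) (hDelta : coproduct iota Delta)
    (trU : {bilinear U -> U -> U})
    (htrU : post_lie_extension tr iota Delta trU)
    (f : L) (s : nat) (a : 'M[R]_s) (b : 'rV[R]_s) (p : nat)
    (hab : order_conditions a b p) :
  bigO_h p.+1 (fun n =>
    rkmk iota trU a b (fps_h f) n
    - fps_exp (star Delta trU) (fps_h (iota f)) n).
Proof.
have hbr := uea_lie hU.
pose K := rkmk_solution iota trU a (fps_h f).
have stagesK : rkmk_stages iota trU a (fps_h f) K.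
  exact: xgetPex (rkmk_stages_exist hbr hDelta htrU a f).
have [_ KE] := (rkmk_stagesP iota trU a f K).1 stagesK.
have KU i : (fun n => iota (K i n)) = stage_rhs trU (iota f)
    (fun n => \sum_j a i j *: iota (K j n)).
  rewrite KE; congr stage_rhs; apply: funext => n.
  by rewrite linear_sum; apply: eq_bigr => j _; rewrite linearZ.
have [theta [theta0 thetaE]] := exact_flow_exists hbr hDelta htrU f.
move=> n; rewrite ltnS => le_np; apply/eqP; rewrite subr_eq0; apply/eqP.
rewrite -(exp_exact_flow hDelta htrU theta0 thetaE).
apply: eq_fps_exp => m le_mn; rewrite linear_sum.
under eq_bigr do rewrite linearZ.
exact: (rk_order KU theta0 thetaE hab (leq_trans le_mn le_np)).
Qed.
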